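(* Let $C_n$ denote the cycle on $n\ge 3$ vertices. Then $c_2(C_n)=2\left\lceil \frac{n}{2}\right\rceil$.
   Context: All graphs are finite and simple. Let $G$ be a graph and $k\ge 2$ an integer. A multiset $\mathscr{P}$ of paths in $G$ is a $k$-rainbow separating path system ($k$-RSPS) if its elements can be colored with (at most) $k$ colors so that for every pair of distinct edges $e_1,e_2\in E(G)$ there exist paths $P_1,P_2\in\mathscr{P}$ of distinct colors such that $P_1$ contains $e_1$ but not $e_2$, and $P_2$ contains $e_2$ but not $e_1$. The $k$-rainbow separation number $c_k(G)$ is the smallest cardinality (with multiplicity) of a $k$-RSPS of $G$. *)

(* Defs.v *)
From HB Require Import structures.
From mathcomp Require Import all_boot.
From mathcomp Require Import boolp.

Set Implicit Arguments.
Unset Strict Implicit.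
Unset Printing Implicit Defensive.

Record sgraph := SGraph {
  vertex :> finType;
  adj : rel vertex;
  adj_sym : symmetric adj;
  adj_irrefl : irreflexive adj }.

Definition edges (G : sgraph) : {set {set G}} :=
  [set [set u.1; u.2] | u : G * G & adj u.1 u.2].

(* A path is given by one of its two traversals. A traversal and its reversal
   have the same edges, so the choice does not affect the cardinality of a
   separating multiset of paths. *)
Record gpath (G : sgraph) := GPath {
  gpath_head : G;
  gpath_tail : seq G;
  gpath_adj : path (@adj G) gpath_head gpath_tail;
  gpath_uniq : uniq (gpath_head :: gpath_tail) }.

Definition gpath_edges (G : sgraph) (P : gpath G) : seq {set G} :=
  pairmap (fun x y => [set x; y]) (gpath_head P) (gpath_tail P).

(* A multiset of m paths is listed as an m-tuple; colors are assigned to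
   positions, so two copies of one path may receive different colors. *)
Definition is_RSPS (k : nat) (G : sgraph) (m : nat) (Ps : m.-tuple (gpath G)) :
    Prop :=
  exists c : 'I_m -> 'I_k,
    forall e1 e2 : {set G}, e1 \in edges G -> e2 \in edges G -> e1 != e2 ->
    exists i j : 'I_m,
      [/\ c i != c j,
          (e1 \in gpath_edges (tnth Ps i)) && (e2 \notin gpath_edges (tnth Ps i))
        & (e2 \in gpath_edges (tnth Ps j)) && (e1 \notin gpath_edges (tnth Ps j))].

Definition has_RSPS (k : nat) (G : sgraph) (m : nat) : Prop :=
  exists Ps : m.-tuple (gpath G), is_RSPS k Ps.

Lemma edge_gpath (G : sgraph) (e : {set G}) :
  e \in edges G -> exists P : gpath G, gpath_edges P = [:: e].
Proof.
case/imsetP=> -[x y]; rewrite inE /= => xy ->.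
have hp : path (@adj G) x [:: y] by rewrite /= xy.
have hu : uniq [:: x; y].
  by rewrite /= inE andbT; apply: contraTneq xy => ->; rewrite adj_irrefl.
by exists (GPath hp hu).
Qed.

(* All single-edge paths, each taken once with each of two colors. *)
Lemma ex_RSPS (k : nat) (hk : 1 < k) (G : sgraph) :
  exists m, `[< has_RSPS k G m >].
Proof.
pose I := ('I_#|edges G| * bool)%type.
have hP (i : I) : exists P : gpath G, gpath_edges P = [:: enum_val i.1].
  exact/edge_gpath/enum_valP.
have [F hF] := choice hP.
exists #|{: I}|; apply/asboolP.
exists [tuple F (enum_val i) | i < #|{: I}|].
have k0 : 0 < k by apply: ltnW.
exists (fun i => if (enum_val i).2 then Ordinal hk else Ordinal k0).
move=> e1 e2 h1 h2 ne.
exists (enum_rank (enum_rank_in h1 e1, true)).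
exists (enum_rank (enum_rank_in h2 e2, false)).
rewrite !tnth_mktuple !enum_rankK !hF /= !enum_rankK_in // !inE !eqxx.
by rewrite ne eq_sym ne.
Qed.

Definition rainbow_number (k : nat) (hk : 1 < k) (G : sgraph) : nat :=
  ex_minn (ex_RSPS hk G).

Section Cycle.
Variable n : nat.

(* The conjunct i != j only matters for n = 1, where it excludes a loop. *)
Definition cycle_adj : rel 'I_n := fun i j =>
  (i != j) && ((j == i.+1 %% n :> nat) || (i == j.+1 %% n :> nat)).

Lemma cycle_adj_sym : symmetric cycle_adj.
Proof. by move=> i j; rewrite /cycle_adj eq_sym orbC. Qed.

Lemma cycle_adj_irrefl : irreflexive cycle_adj.
Proof. by move=> i; rewrite /cycle_adj eqxx. Qed.

Definition cycle_graph : sgraph := SGraph cycle_adj_sym cycle_adj_irrefl.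

End Cycle.

(* Main.v *)
Require Import Defs.
From mathcomp Require Import all_boot.
From mathcomp Require Import boolp zify.

(** Lower bound.  Call a path leaving at the vertex [w] if it contains the edge
    on one side of [w] but not the edge on the other side.  Separating the two
    edges at [w] forces two paths of distinct colors to leave at [w], one from
    each side.  A path in a cycle runs in a single direction, so it leaves from
    a given side at no more than one vertex ([exit_unique]): assigning to [w]
    its path leaving from a given side is an injection.  Fix one of the two
    colors.  At each vertex that color is used by one of the two leaving paths,
    so the two injections together hit its color class [n] times, each path
    being hit at most twice.  Hence each color class has at least
    [uphalf n] paths ([uphalf_le_color_class]), and there are two classes.
    Bounding the classes one at a time, rather than the whole system, is what
    gives the rounding up for odd [n].

    Upper bound.  Let [k = uphalf n].  For [t < k], cut the cycle at the
    vertices [t] and [t + k] (mod [n]) into two complementary arcs, one of each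
    color ([exists_cut]).  If exactly one of two edges lies in the arc
    from [t] to [t + k], then the two arcs of this cut separate these edges in
    distinct colors.  So it suffices that every pair of edges is split by one
    of the [k] windows of length [k] ([half_window_separates]). *)

(** * Counting *)

Lemma uphalf_card_cover (W I : finType) (p q : W -> I) (A : {set I}) :
  injective p -> injective q -> (forall w, (p w \in A) || (q w \in A)) ->
  uphalf #|W| <= #|A|.
Proof.
move=> p_inj q_inj cov.
have preim_le (h : W -> I) : injective h -> #|h @^-1: A| <= #|A|.
  move=> h_inj; rewrite -(card_imset _ h_inj); apply: subset_leq_card.
  by apply/subsetP=> i /imsetP[w]; rewrite inE => wA ->.
have: #|W| <= #|p @^-1: A| + #|q @^-1: A|.
  apply: leq_trans (leq_card_setU _ _); rewrite -cardsT.
  by apply/subset_leq_card/subsetP=> w _; rewrite !inE.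
by have := preim_le p p_inj; have := preim_le q q_inj; lia.
Qed.

(** * Paths that follow a permutation or its inverse *)

(** After a step by [f], a step by [g] would return to the vertex just left. *)
Lemma uniq_path_onward (T : eqType) (f g : T -> T) (x : T) (s : seq T) :
  cancel f g -> path [rel u v | (v == f u) || (v == g u)] (f x) s ->
  uniq [:: x, f x & s] -> fpath f (f x) s.
Proof.
move=> fK; elim: s x => //= z s IHs x /andP[/orP[]/eqP-> {z} zs].
  move=> /and4P[_ fxN zN us]; rewrite eqxx; apply: IHs => //=.
  by rewrite fxN zN.
by rewrite fK !inE eqxx orbT.
Qed.

Lemma uniq_path_monotone (T : eqType) (f g : T -> T) (x : T) (s : seq T) :
  cancel f g -> cancel g f ->
  path [rel u v | (v == f u) || (v == g u)] x s -> uniq (x :: s) ->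
  fpath f x s \/ fpath g x s.
Proof.
move=> fK gK; case: s => [|y s]; first by left.
move=> /andP[/orP[]/eqP-> /= ys] us; rewrite eqxx /=; [left | right].
  exact: uniq_path_onward fK ys us.
apply: uniq_path_onward gK _ us; apply: sub_path ys => u v /=.
by rewrite orbC.
Qed.

(* For [f] the successor on the cycle, the edge on one side of [v]; for [f] the
   predecessor, the edge on its other side. *)
Local Notation fstep f v := [set v; f v].

(** Two points with the same step are equal or exchanged by [f]. *)
Lemma step_inj (T : finType) (f : T -> T) :
  (forall v, f (f v) != v) -> injective (fun v => fstep f v).
Proof.
move=> ff u v /setP E.
have := E u; rewrite !inE eqxx => /esym/orP[/eqP//|/eqP uE].
have := E v; rewrite !inE eqxx => /orP[/eqP//|/eqP vE].
by case/eqP: (ff u); rewrite -vE -uE.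
Qed.

Local Notation path_edges x s := (pairmap (fun u v => [set u; v]) x s).

(** A path running along [f] continues from every vertex but the last, so the
    last vertex is the only place where the next edge can be missing. *)
Lemma fpath_exit_last (T : finType) (f g : T -> T) (x w : T) (s : seq T) :
  cancel f g -> cancel g f -> (forall v, f (f v) != v) -> fpath f x s ->
  fstep g w \in path_edges x s -> fstep f w \notin path_edges x s ->
  w = last x s.
Proof.
move=> fK gK ff; elim: s x => //= y s IHs x /andP[/eqP<-{y} ps].
rewrite !inE negb_or => /orP[/eqP E|gin] /andP[_ fN]; last exact: IHs.
have {E} xE : x = g w.
  by apply: (step_inj _ _ ff); rewrite -E /= gK setUC.
move: ps fN; rewrite xE gK; case: s {IHs} => //= z s /andP[/eqP<- _].
by rewrite inE eqxx.
Qed.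

(** Read from its head, a path running along [g] meets the edge beyond [w]
    just before reaching [w], unless it starts there. *)
Lemma fpath_exit_head (T : finType) (f g : T -> T) (x w : T) (s : seq T) :
  cancel f g -> cancel g f -> (forall v, g (g v) != v) -> fpath g x s ->
  fstep g w \in path_edges x s -> fstep f w \notin path_edges x s ->
  w = x.
Proof.
move=> fK gK gg; elim: s x => //= y s IHs x /andP[/eqP<-{y} ps].
rewrite !inE negb_or => /orP[/eqP E|gin] /andP[fN fN'].
  exact: (step_inj _ _ gg).
by case/eqP: fN; rewrite (IHs _ ps gin fN') gK setUC.
Qed.

(** The vertex is the last one or the head according to the direction of the
    path, and this direction does not depend on the vertex. *)
Lemma exit_unique (T : finType) (f g : T -> T) (x w w' : T) (s : seq T) :
  cancel f g -> cancel g f -> (forall v, f (f v) != v) ->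
  path [rel u v | (v == f u) || (v == g u)] x s -> uniq (x :: s) ->
  fstep g w \in path_edges x s -> fstep f w \notin path_edges x s ->
  fstep g w' \in path_edges x s -> fstep f w' \notin path_edges x s ->
  w = w'.
Proof.
move=> fK gK ff ps us gw fw gw' fw'.
have gg v : g (g v) != v.
  by apply: contra (ff v) => /eqP E; rewrite -{1}E !gK.
have [pf|pg] := uniq_path_monotone _ f g x s fK gK ps us.
  by rewrite (fpath_exit_last _ f g x w s) // -(fpath_exit_last _ f g x w' s).
by rewrite (fpath_exit_head _ f g x w s) // -(fpath_exit_head _ f g x w' s).
Qed.

(** * The cycle graph *)

Lemma ordS2_neq (n : nat) (v : 'I_n) : 3 <= n -> ordS (ordS v) != v.
Proof.
move=> hn; rewrite -val_eqE /=; have := ltn_ord v.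
rewrite -[(_ %% _).+1]addn1 modnDml addn1; case: (ltnP v.+2 n) => [h _|h hv].
  by rewrite modn_small //; lia.
have -> : v.+2 = v.+2 - n + n by lia.
by rewrite modnDr modn_small; lia.
Qed.

Lemma ord_pred2_neq (n : nat) (v : 'I_n) :
  3 <= n -> ord_pred (ord_pred v) != v.
Proof.
move=> hn; apply: contra (ordS2_neq n v hn) => /eqP E.
by rewrite -{1}E !ord_predK.
Qed.

Lemma cycle_adjE (n : nat) (u v : 'I_n) : 3 <= n ->
  cycle_adj u v = (v == ordS u) || (v == ord_pred u).
Proof.
move=> hn; rewrite /cycle_adj -[u.+1 %% n]/(val (ordS u)).
rewrite -[v.+1 %% n]/(val (ordS v)) !val_eqE.
rewrite [u == ordS v]eq_sym (can2_eq (@ordSK n) (@ord_predK n)) [u == v]eq_sym.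
case: (v =P u) => //= ->; apply/esym/norP; split.
  by apply: contra (ordS2_neq n u hn) => /eqP E; rewrite -!E.
by apply: contra (ord_pred2_neq n u hn) => /eqP E; rewrite -!E.
Qed.

Lemma cycle_edgeP (n : nat) (e : {set 'I_n}) : 3 <= n ->
  reflect (exists v : 'I_n, e = fstep (@ordS n) v)
          (e \in edges (cycle_graph n)).
Proof.
move=> hn; apply: (iffP imsetP) => [[[u v]]|[v ->]].
  rewrite inE /= cycle_adjE // => /orP[]/eqP-> ->; first by exists u.
  by exists (ord_pred u); rewrite ord_predK setUC.
by exists (v, ordS v); rewrite // inE /= cycle_adjE // eqxx.
Qed.

(** * Lower bound *)

(** [A] stands for either color class: with two colors, paths of distinct
    colors cannot both avoid it. *)
Lemma uphalf_le_color_class (n m : nat) (Ps : m.-tuple (gpath (cycle_graph n)))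
    (A : {set 'I_m}) : 3 <= n ->
  (forall e1 e2 : {set cycle_graph n}, e1 \in edges (cycle_graph n) ->
     e2 \in edges (cycle_graph n) -> e1 != e2 ->
     exists i j : 'I_m,
      [/\ (i \in A) || (j \in A),
          (e1 \in gpath_edges (tnth Ps i)) && (e2 \notin gpath_edges (tnth Ps i))
        & (e2 \in gpath_edges (tnth Ps j)) && (e1 \notin gpath_edges (tnth Ps j))]) ->
  uphalf n <= #|A|.
Proof.
move=> hn sep.
have ex (w : 'I_n) : exists ij : 'I_m * 'I_m,
    [/\ (ij.1 \in A) || (ij.2 \in A),
        (fstep (@ord_pred n) w \in gpath_edges (tnth Ps ij.1))
          && (fstep (@ordS n) w \notin gpath_edges (tnth Ps ij.1))
      & (fstep (@ordS n) w \in gpath_edges (tnth Ps ij.2))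
          && (fstep (@ord_pred n) w \notin gpath_edges (tnth Ps ij.2))].
  have [||| i [j ijP]] := sep (fstep (@ord_pred n) w) (fstep (@ordS n) w).
  - apply/cycle_edgeP => //; exists (ord_pred w).
    by rewrite ord_predK setUC.
  - by apply/cycle_edgeP => //; exists w.
  - apply: contra (ordS2_neq n (ord_pred w) hn) => /eqP E.
    have wE : ord_pred w = w.
      apply: (step_inj _ (@ordS n)); first by move=> v; apply: ordS2_neq.
      by rewrite /= ord_predK -E setUC.
    have sE : ordS w = w by rewrite -{1}wE ord_predK.
    by rewrite wE !sE.
  by exists (i, j).
have [h hP] := choice ex.
have mono i : let P := tnth Ps i in
    path [rel u v : 'I_n | (v == ordS u) || (v == ord_pred u)]
      (gpath_head P) (gpath_tail P).
  apply: sub_path (gpath_adj (tnth Ps i)) => u v.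
  by rewrite /= -cycle_adjE.
rewrite -[n in uphalf n]card_ord.
apply: (@uphalf_card_cover _ _ (fun w => (h w).1) (fun w => (h w).2)).
- move=> w w' E; have [_ /andP[pw sw] _] := hP w.
  have [_ /andP[pw' sw'] _] := hP w'; rewrite -E in pw' sw'.
  apply: (exit_unique _ (@ordS n) (@ord_pred n)) pw sw pw' sw'.
  + exact: ordSK.
  + exact: ord_predK.
  + by move=> v; apply: ordS2_neq.
  + exact: mono.
  + exact: gpath_uniq.
(* Leaving from the other side is the same situation with successor and
   predecessor exchanged. *)
- move=> w w' E; have [_ _ /andP[pw sw]] := hP w.
  have [_ _ /andP[pw' sw']] := hP w'; rewrite -E in pw' sw'.
  apply: (exit_unique _ (@ord_pred n) (@ordS n)) pw sw pw' sw'.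
  + exact: ord_predK.
  + exact: ordSK.
  + by move=> v; apply: ord_pred2_neq.
  + by apply: sub_path (mono (h w).2) => u v /=; rewrite orbC.
  + exact: gpath_uniq.
- by move=> w; case: (hP w).
Qed.

Lemma RSPS_cycle_lower (n m : nat) : 3 <= n ->
  has_RSPS 2 (cycle_graph n) m -> 2 * uphalf n <= m.
Proof.
move=> hn [Ps [c cP]]; pose A := [set i | c i == ord0].
have color2 (x y : 'I_2) : x != y -> (x == ord0) != (y == ord0).
  by rewrite -!val_eqE /=; case: x y => [[|[]]//?] [[|[]]//?].
have leA : uphalf n <= #|A|.
  apply: (@uphalf_le_color_class n m Ps) => // e1 e2 h1 h2 ne.
  have [i [j [cij ? ?]]] := cP _ _ h1 h2 ne; exists i, j; split=> //.
  by rewrite !inE; move: (color2 _ _ cij); case: (c i == _); case: (c j == _).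
have leAC : uphalf n <= #|~: A|.
  apply: (@uphalf_le_color_class n m Ps) => // e1 e2 h1 h2 ne.
  have [i [j [cij ? ?]]] := cP _ _ h1 h2 ne; exists i, j; split=> //.
  by rewrite !inE; move: (color2 _ _ cij); case: (c i == _); case: (c j == _).
by have := cardsC A; rewrite card_ord; lia.
Qed.

(** * Upper bound *)

Lemma val_iter_ordS (n i : nat) (v : 'I_n) :
  val (iter i (@ordS n) v) = (v + i) %% n.
Proof.
elim: i => [|i IHi]; first by rewrite /= addn0 modn_small.
by rewrite iterS /= IHi -addn1 modnDml addn1 addnS.
Qed.

Lemma pairmap_traject (T : finType) (f : T -> T) (x : T) (l : nat) :
  path_edges x (traject f (f x) l) = [seq fstep f w | w <- traject f x l].
Proof. by elim: l x => //= l IHl x; rewrite IHl. Qed.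

Lemma exists_arc (n l : nat) (v : 'I_n) : 3 <= n -> l < n ->
  exists P : gpath (cycle_graph n), forall w : 'I_n,
    (fstep (@ordS n) w \in gpath_edges P) = (w \in traject (@ordS n) v l).
Proof.
move=> hn ln.
have adjP : path (@adj (cycle_graph n)) v (traject (@ordS n) (ordS v) l).
  apply: sub_path (fpath_traject (@ordS n) v l) => x y /eqP <-.
  by rewrite /= cycle_adjE // eqxx.
have uniqP : uniq (v :: traject (@ordS n) (ordS v) l).
  rewrite -trajectS looping_uniq; apply/trajectP => -[i il].
  move/(congr1 val); rewrite /= !val_iter_ordS => /eqP.
  by rewrite eqn_modDl !modn_small ?(ltn_trans il) // => /eqP; lia.
exists (@GPath (cycle_graph n) _ _ adjP uniqP) => w.
rewrite /gpath_edges /= pairmap_traject.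
exact: (mem_map (step_inj _ _ (fun u => ordS2_neq n u hn))).
Qed.

(** As [t + uphalf n <= n], the arc from [t] does not wrap around, so it is
    described by plain inequalities; its complement starts at
    [(t + uphalf n) %% n] and in general wraps around. *)
Lemma exists_cut (n t : nat) : 3 <= n -> t < uphalf n ->
  exists P : bool -> gpath (cycle_graph n), forall b (w : 'I_n),
    (fstep (@ordS n) w \in gpath_edges (P b)) = ((t <= w < t + uphalf n) == b).
Proof.
set k := uphalf n => hn tk.
have kn : k < n by rewrite /k; lia.
have nk2 : n <= 2 * k <= n.+1 by rewrite /k; lia.
have tn : t < n by lia.
have [P PP] := exists_arc n k (Ordinal tn) hn kn.
have ltk : (t + k) %% n < n by rewrite ltn_mod; lia.
have kn' : n - k < n by lia.
have [Q QP] := exists_arc n (n - k) (Ordinal ltk) hn kn'.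
exists (fun b => if b then P else Q) => -[] w.
  rewrite PP eqb_id; apply/trajectP/idP => [[i ik ->]|/andP[tw wt]].
    by rewrite val_iter_ordS modn_small /=; lia.
  exists (w - t); first lia.
  by apply: val_inj; rewrite val_iter_ordS /= subnKC // modn_small.
have itE i : val (iter i (@ordS n) (Ordinal ltk)) = (t + k + i) %% n.
  by rewrite val_iter_ordS /= modnDml.
have wn := ltn_ord w.
rewrite QP eqbF_neg; apply/trajectP/idP => [[i ik ->]|wN].
  rewrite itE; case: (ltnP (t + k + i) n) => h; first by rewrite modn_small; lia.
  rewrite -(subnK h) modnDr modn_small; lia.
case: (ltnP w t) => [wt|tw].
  exists (w + n - (t + k)); first lia.
  apply: val_inj; rewrite itE subnKC; last lia.
  by rewrite modnDr modn_small.
exists (w - (t + k)); first lia.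
apply: val_inj; rewrite itE subnKC; last lia.
by rewrite modn_small.
Qed.

(** Let [i < j].  A window ending at [i] misses [j], and one is available unless
    [i] is small.  A window starting at [i] then misses [j] when [j] is far, and
    the window starting just after [i] catches [j] otherwise. *)
Lemma half_window_separates (n i j : nat) : i < n -> j < n -> i != j ->
  exists2 t, t < uphalf n &
    (t <= i < t + uphalf n) != (t <= j < t + uphalf n).
Proof.
wlog ij : i j / i < j => [wl iN jN ne|iN jN _].
  case: (ltngtP i j) (ne) => // h _; first exact: wl.
  have [//|//||t tk sep] := wl j i h; first by rewrite eq_sym.
  by exists t => //; rewrite eq_sym.
set k := uphalf n; have nk2 : n <= 2 * k <= n.+1 by rewrite /k; lia.
have [ki|ik] := leqP k.-1 i; first by exists (i - k.-1); lia.
have [ikj|jik] := leqP (i + k) j; first by exists i; lia.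
by exists i.+1; lia.
Qed.

Lemma RSPS_cycle_upper (n : nat) : 3 <= n ->
  has_RSPS 2 (cycle_graph n) (2 * uphalf n).
Proof.
move=> hn; pose I := ('I_(uphalf n) * bool)%type.
have -> : 2 * uphalf n = #|{: I}|.
  by rewrite card_prod card_ord card_bool mulnC.
have [F FP] := choice (fun t : 'I_(uphalf n) => exists_cut n t hn (ltn_ord t)).
(* The index [(t, b)] is one side of the cut at [t]; its color is [b]. *)
exists [tuple F (enum_val i).1 (enum_val i).2 | i < #|{: I}|].
exists (fun i => if (enum_val i).2 then ord0 else ord_max).
move=> _ _ /(cycle_edgeP _ _ hn)[u ->] /(cycle_edgeP _ _ hn)[v ->] ne.
have uv : u != v :> nat by apply: contraNneq ne => /val_inj->.
have [t tk sep] := half_window_separates n u v (ltn_ord u) (ltn_ord v) uv.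
pose b := t <= u < t + uphalf n.
exists (enum_rank (Ordinal tk, b)), (enum_rank (Ordinal tk, ~~ b)).
rewrite !tnth_mktuple !enum_rankK !FP /= -/b eqxx.
by move: sep; rewrite -/b; case: b; case: (t <= v < _).
Qed.

Theorem theorem2p2 (n : nat) (hn : 3 <= n) :
  @rainbow_number 2 isT (cycle_graph n) = 2 * uphalf n.
Proof.
rewrite /rainbow_number; case: ex_minnP => m /asboolP sys min_m.
apply/eqP; rewrite eqn_leq (RSPS_cycle_lower _ _ hn sys) andbT.
by apply/min_m/asboolP/RSPS_cycle_upper.
Qed.
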